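(* Let $n\in\mathbb{N}$ and let $X_1,\ldots,X_n,Y$ be linearly stable sequence classes such that $X_1(\mathbb{K})\cdots X_n(\mathbb{K})\stackrel{1}{\hookrightarrow}Y(\mathbb{K})$. Then $(\mathcal{L}_{X_1,\ldots,X_n;Y},\|\cdot\|_{X_1,\ldots,X_n;Y})$ is a Banach ideal of $n$-linear operators.
   Context: All Banach spaces are over a fixed field $\mathbb{K}=\mathbb{R}$ or $\mathbb{C}$. $\mathcal{L}(E_1,\ldots,E_n;F)$ is the Banach space of continuous $n$-linear operators $E_1\times\cdots\times E_n\to F$ with the sup norm $\|A\|$ over the product of closed unit balls. $c_{00}(E)$ is the set of finite $E$-valued sequences (completed with zeros to infinite sequences), $\ell_\infty(E)$ is the space of bounded $E$-valued sequences with the sup norm, and $e_j$ is the $j$-th canonical unit scalar sequence. Sequence class: a rule $X$ assigning to each Banach space $E$ a Banach space $X(E)$ of $E$-valued sequences (a vector subspace of $E^{\mathbb{N}}$ with coordinatewise operations) such that $c_{00}(E)\subseteq X(E)\subseteq\ell_\infty(E)$, $\|x\|_{\ell_\infty(E)}\le\|x\|_{X(E)}$ for all $x\in X(E)$, and $\|e_j\|_{X(\mathbb{K})}=1$ for every $j$. Linearly stable: a sequence class $X$ is linearly stable if for all Banach spaces $E,F$ and every $u\in\mathcal{L}(E;F)$ one has $(u(x_j))_{j=1}^\infty\in X(F)$ whenever $(x_j)_{j=1}^\infty\in X(E)$, and the induced operator $\widehat u\colon X(E)\to X(F)$, $\widehat u((x_j)_j)=(u(x_j))_j$, satisfies $\|\widehat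 u\|=\|u\|$. $X_1(\mathbb{K})\cdots X_n(\mathbb{K})\stackrel{1}{\hookrightarrow}Y(\mathbb{K})$ means: whenever $(\lambda_j^m)_{j=1}^\infty\in X_m(\mathbb{K})$, $m=1,\ldots,n$, one has $(\lambda_j^1\cdots\lambda_j^n)_{j=1}^\infty\in Y(\mathbb{K})$ and $\|(\lambda_j^1\cdots\lambda_j^n)_{j=1}^\infty\|_{Y(\mathbb{K})}\le\prod_{m=1}^n\|(\lambda_j^m)_{j=1}^\infty\|_{X_m(\mathbb{K})}$. $\mathcal{L}_{X_1,\ldots,X_n;Y}(E_1,\ldots,E_n;F)$ is the set of all $A\in\mathcal{L}(E_1,\ldots,E_n;F)$ such that $(A(x_j^1,\ldots,x_j^n))_{j=1}^\infty\in Y(F)$ whenever $(x_j^m)_{j=1}^\infty\in X_m(E_m)$, $m=1,\ldots,n$. For such $A$ the induced map $\widehat A\colon X_1(E_1)\times\cdots\times X_n(E_n)\to Y(F)$, $\widehat A((x_j^1)_j,\ldots,(x_j^n)_j)=(A(x_j^1,\ldots,x_j^n))_j$, is a continuous $n$-linear operator, and $\|A\|_{X_1,\ldots,X_n;Y}:=\|\widehat A\|$. $\mathcal{L}_{X_1,\ldots,X_n;Y}$ is the class of all such operators, over all Banach spaces $E_1,\ldots,E_n,F$. An $n$-linear operator of finite type is a linear combination of operators $(x_1,\ldots,x_n)\mapsto\varphi_1(x_1)\cdots\varphi_n(x_n)b$ with $\varphi_m\in E_m'$ (the topological dual) and $b\in F$. Banach ideal of $n$-linear operators: a pair $(\mathcal{M}_n,\|\cdot\|_{\mathcal{M}_n})$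 where $\mathcal{M}_n$ is a subclass of the class of all $n$-linear operators between Banach spaces and $\|\cdot\|_{\mathcal{M}_n}\colon\mathcal{M}_n\to\mathbb{R}$ is a function such that for all Banach spaces $E_1,\ldots,E_n,F$ the component $\mathcal{M}_n(E_1,\ldots,E_n;F):=\mathcal{L}(E_1,\ldots,E_n;F)\cap\mathcal{M}_n$ is a linear subspace of $\mathcal{L}(E_1,\ldots,E_n;F)$ on which $\|\cdot\|_{\mathcal{M}_n}$ is a complete norm, and: (i) $\mathcal{M}_n(E_1,\ldots,E_n;F)$ contains the $n$-linear operators of finite type, and the operator $I_n\colon\mathbb{K}^n\to\mathbb{K}$, $I_n(\lambda_1,\ldots,\lambda_n)=\lambda_1\cdots\lambda_n$, satisfies $\|I_n\|_{\mathcal{M}_n}=1$; (ii) if $A\in\mathcal{M}_n(E_1,\ldots,E_n;F)$, $u_m\in\mathcal{L}(G_m;E_m)$ for $m=1,\ldots,n$, and $v\in\mathcal{L}(F;H)$, then $v\circ A\circ(u_1,\ldots,u_n)\in\mathcal{M}_n(G_1,\ldots,G_n;H)$ and $\|v\circ A\circ(u_1,\ldots,u_n)\|_{\mathcal{M}_n}\le\|v\|\cdot\|A\|_{\mathcal{M}_n}\cdot\|u_1\|\cdots\|u_n\|$. *)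

(* Defs.v *)
From HB Require Import structures.
From mathcomp Require Import all_boot all_order all_algebra.
From mathcomp Require Import complex.
From mathcomp Require Import all_classical all_reals all_analysis.
From mathcomp Require Import lra.

Set Implicit Arguments.
Unset Strict Implicit.
Unset Printing Implicit Defensive.

Import Order.TTheory GRing.Theory Num.Theory.
Import numFieldNormedType.Exports.

Local Open Scope classical_set_scope.
Local Open Scope ring_scope.

Inductive field_kind := RealField | ComplexField.

Definition ground_field (R : realType) (k : field_kind) : numFieldType :=
  match k with RealField => R | ComplexField => R[i] end.

Definition ground_re (R : realType) (k : field_kind) : ground_field R k -> R :=
  match k with
  | RealField => fun x : R => x
  | ComplexField => fun z : R[i] => complex.Re z
  end.

Lemma complex_complete (R : realType) (F : set_system (R[i])^o) :
  ProperFilter F -> cauchy F -> cvg F.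
Proof.
move=> FF /cauchyP Fc.
have sub (f : (R[i])^o -> R) : (forall x y, f (x - y) = f x - f y) ->
    (forall x : R[i], (`|f x|%:C)%C <= `|x|) -> cvg (f @ F).
  move=> fB fle; apply/cauchy_cvgP/cauchy_exP => e e0.
  have [|x Fx] := Fc (e%:C)%C; first by rewrite ltcR.
  exists (f x); apply: (@filterS _ F _ _ _ _ Fx) => y xy.
  suff : `|f x - f y| < e by [].
  rewrite -fB -ltcR; apply: le_lt_trans (fle _) _; exact: xy.
have Im_le (x : R[i]) : (`|complex.Im x|%:C)%C <= `|x|.
  by case: x => a b; rewrite normc_def lecR /= -sqrtr_sqr ler_wsqrtr // lerDr sqr_ge0.
have /cvg_ex[/= a Fa] : cvg ((@complex.Re R : (R[i])^o -> R) @ F).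
  by apply: sub => [[? ?] [? ?]//|]; exact: normc_ge_Re.
have /cvg_ex[/= b Fb] : cvg ((@complex.Im R : (R[i])^o -> R) @ F).
  by apply: sub => [[? ?] [? ?]//|]; exact: Im_le.
apply/cvg_ex; exists (a +i* b)%C.
apply/cvgrPdist_lt => e e0.
have [r r0 er] : exists2 r : R, 0 < r & e = (r%:C)%C.
  case: e e0 => x y; rewrite ltcE /= => /andP[/eqP -> x0].
  by exists x.
have h0 : 0 < r / 2 by rewrite divr_gt0.
near=> z.
have za : `|a - complex.Re z| < r / 2.
  by near: z; exact: (Fa _ (nbhsx_ballx _ _ h0)).
have zb : `|b - complex.Im z| < r / 2.
  by near: z; exact: (Fb _ (nbhsx_ballx _ _ h0)).
rewrite er (_ : _ - _ = ((a - complex.Re z) +i* (b - complex.Im z))%C); last first.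
  by clear; case: z.
rewrite normc_def ltcR /= -[ltRHS]gtr0_norm// -sqrtr_sqr ltr_sqrt ?exprn_gt0//.
have ? : (a - complex.Re z) ^+ 2 <= (r / 2) ^+ 2.
  by rewrite -real_normK ?num_real// lerXn2r ?nnegrE ?normr_ge0 ?ltW.
have ? : (b - complex.Im z) ^+ 2 <= (r / 2) ^+ 2.
  by rewrite -real_normK ?num_real// lerXn2r ?nnegrE ?normr_ge0 ?ltW.
have : 0 < r ^+ 2 by rewrite exprn_gt0.
by nra.
Unshelve. all: by end_near. Qed.

Lemma ground_complete (R : realType) (k : field_kind)
    (F : set_system (ground_field R k)^o) :
  ProperFilter F -> cauchy F -> cvg F.
Proof. by case: k F => F; [exact: R_complete | exact: complex_complete]. Qed.

Definition ground_banach (R : realType) (k : field_kind) :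
    completeNormedModType (ground_field R k) :=
  HB.pack (ground_field R k)^o
    (Uniform_isComplete.Build (ground_field R k)^o (@ground_complete R k)).

Section Definitions.
Variables (R : realType) (k : field_kind).
Local Notation K := (ground_field R k).
Local Notation banach := (completeNormedModType K).
Local Notation KB := (ground_banach R k).

(* The library norm of a normed K-module takes its values in K. *)
Definition rnorm (V : normedModType K) (x : V) : R := ground_re `|x|.

(* Only the values of N on S matter. *)
Record complete_norm (V : lmodType K) (S : set V) (N : V -> R) : Prop := {
  cn_subspace0 : S 0;
  cn_subspaceP : forall (a : K) x y, S x -> S y -> S (a *: x + y);
  cn_ge0 : forall x, S x -> 0 <= N x;
  cn_eq0 : forall x, S x -> N x = 0 -> x = 0;
  cn_homog : forall (a : K) x, S x -> N (a *: x) = rnorm (a : KB) * N x;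
  cn_triangle : forall x y, S x -> S y -> N (x + y) <= N x + N y;
  cn_complete : forall u : nat -> V, (forall i, S (u i)) ->
    (forall e : R, 0 < e ->
       exists i0, forall i j, (i0 <= i)%N -> (i0 <= j)%N -> N (u i - u j) < e) ->
    exists2 l, S l & N (u i - l) @[i --> \oo] --> (0 : R)
}.

Definition unit_seq (j : nat) : nat -> KB := fun i => (i == j)%:R.

(* X E is the space X(E) and seq_norm X its norm, which is meaningful on X E
   only. *)
Record sequence_class := SequenceClass {
  seq_space :> forall E : banach, set (nat -> E);
  seq_norm : forall E : banach, (nat -> E) -> R;
  seq_banach : forall E : banach, complete_norm (@seq_space E) (@seq_norm E);
  seq_c00 : forall (E : banach) (x : nat -> E),
    (exists j0, forall j, (j0 <= j)%N -> x j = 0) -> seq_space x;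
  seq_linfty : forall (E : banach) (x : nat -> E), seq_space x ->
    has_ubound (range (fun j => rnorm (x j))) /\
    sup (range (fun j => rnorm (x j))) <= seq_norm x;
  seq_canon : forall j, seq_norm (unit_seq j) = 1
}.

Arguments seq_norm X {E} x : rename.
Arguments seq_space X E _ : rename.

Definition opnorm (E F : banach) (u : E -> F) : R :=
  sup [set rnorm (u x) | x in [set x | rnorm x <= 1]].

(* The requirement that the induced operator be bounded is part of its having a
   norm; it is stated separately since sup is 0 on sets without upper bound. *)
Definition linearly_stable (X : sequence_class) : Prop :=
  forall (E F : banach) (u : {linear E -> F}), continuous u ->
  let hat_values := [set seq_norm X (u \o x) |
                      x in [set x | X E x /\ seq_norm X x <= 1]] in
  [/\ forall x, X E x -> X F (u \o x),
      has_ubound hat_values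
    & sup hat_values = opnorm u].

Section Multilinear.
Variable n : nat.
Implicit Types (E G : 'I_n -> banach) (F H : banach).

Definition multilinear E F (A : (forall m, E m) -> F) : Prop :=
  forall (x : forall m, E m) (m : 'I_n), linear (fun y : E m => A (dfwith x m y)).

Definition cmultilinear E F (A : (forall m, E m) -> F) : Prop :=
  multilinear A /\ continuous (A : prod_topology E -> F).

Definition finite_type E F (A : (forall m, E m) -> F) : Prop :=
  exists (r : nat) (c : 'I_r -> K)
         (phi : 'I_r -> forall m, {linear E m -> KB}) (b : 'I_r -> F),
    (forall i m, continuous (phi i m)) /\
    A = fun x => \sum_i c i *: ((\prod_m (phi i m (x m) : K)) *: b i).

Definition compose E G F H (v : F -> H) (A : (forall m, E m) -> F)
    (u : forall m, G m -> E m) : (forall m, G m) -> H :=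
  fun x => v (A (fun m => u m (x m))).

Definition mul_op : (forall m : 'I_n, KB) -> KB :=
  fun x => \prod_m (x m : K).

(* A class of n-linear operators is given by its components. *)
Definition operator_class : Type :=
  forall E F, set ((forall m, E m) -> F).

Definition operator_norm : Type :=
  forall E F, ((forall m, E m) -> F) -> R.

Definition component (M : operator_class) E F : set ((forall m, E m) -> F) :=
  [set A | cmultilinear A /\ M E F A].

Arguments component M E F _ : clear implicits.

Record banach_ideal (M : operator_class) (N : operator_norm) : Prop := {
  bi_sub : forall E F A, M E F A -> multilinear A;
  bi_banach : forall E F, complete_norm (component M E F) (@N E F);
  bi_finite : forall E F A, finite_type A -> component M E F A;
  bi_mul : N _ _ mul_op = 1;
  bi_ideal : forall E G F H (A : (forall m, E m) -> F)
      (u : forall m, {linear G m -> E m}) (v : {linear F -> H}),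
    component M E F A -> (forall m, continuous (u m)) -> continuous v ->
    component M G H (compose v A u) /\
    N _ _ (compose v A u) <= opnorm v * N _ _ A * \prod_m opnorm (u m)
}.

Definition scalar_embedding (X : 'I_n -> sequence_class) (Y : sequence_class) :
    Prop :=
  forall lam : 'I_n -> nat -> KB,
    (forall m, X m KB (lam m)) ->
    let prod_lam : nat -> KB := fun j => \prod_m (lam m j : K) in
    Y KB prod_lam /\
    seq_norm Y prod_lam <= \prod_m seq_norm (X m) (lam m).

Definition induced E F (A : (forall m, E m) -> F)
    (x : forall m, nat -> E m) : nat -> F :=
  fun j => A (fun m => x m j).

Definition L_class (X : 'I_n -> sequence_class) (Y : sequence_class) :
    operator_class :=
  fun E F => [set A | cmultilinear A /\
    forall x : forall m, nat -> E m,
      (forall m, X m (E m) (x m)) -> Y F (induced A x)].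

(* sup is 0 on sets without upper bound; this does not matter here, since the
   induced operator of every A in L_class X Y E F is bounded (and banach_ideal
   forces it: its norm must be nonzero on nonzero operators). *)
Definition L_norm (X : 'I_n -> sequence_class) (Y : sequence_class) :
    operator_norm :=
  fun E F A => sup [set seq_norm Y (induced A x) |
    x in [set x : forall m, nat -> E m |
            forall m, X m (E m) (x m) /\ seq_norm (X m) (x m) <= 1]].

End Multilinear.
End Definitions.

(* Main.v *)
From HB Require Import structures.
From mathcomp Require Import all_boot all_order all_algebra.
From mathcomp Require Import complex.
From mathcomp Require Import all_classical all_reals all_analysis.
From mathcomp Require Import lra.
Require Import Defs.

(** The heart of the matter is that the induced operator of every [A] in
    [L_class X Y] is bounded; without it [L_norm X Y] would not even be a norm.
    The coordinates of a sequence are continuous functions of the sequence, so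
    in each variable the induced operator has a closed graph, and boundedness
    in one variable is a closed graph theorem, boundedness in all variables
    together a uniform boundedness principle.  Both are instances of a lemma
    of Zabreiko: a seminorm on a Banach space which is countably subadditive is
    bounded on the unit ball, and this holds uniformly for a family of such
    seminorms that is pointwise bounded ([sigma_seminorm_uniform_bounded]).
    It follows from the Baire category theorem and successive approximation.
    A linear map with closed graph, composed with the norm of its target, is
    such a seminorm ([closed_graph_sigma_seminorm]).  In [induced_bounded] the
    variables are then released one after the other: when the first ones range
    over unit balls, they index a family of seminorms in the next variable,
    and the induction hypothesis says that this family is pointwise bounded.

    Two inequalities follow.  By homogeneity, the norm of [induced A x] is at
    most [L_norm X Y A] times the product of the norms of the [x m]
    ([induced_norm_le]).  Linear stability, applied to the operators that send
    a scalar to its multiple of a fixed vector [b], shows that the sequence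
    with first entry [b] and all other entries zero has norm at most that of
    [b]; hence the values of [A] itself obey the same kind of bound
    ([value_norm_le]).

    The remaining properties are consequences.  A Cauchy sequence for
    [L_norm X Y] is, by [value_norm_le], uniformly Cauchy on bounded sets, so
    that it has a continuous multilinear pointwise limit; by [induced_norm_le]
    the induced sequences converge in [Y F], necessarily to the sequence
    induced by the limit.  An operator of rank one belongs to the class because
    the scalar sequences obtained from the functionals multiply into [Y] by the
    embedding hypothesis, after which linear stability of [Y] allows to
    multiply by a vector; the same embedding bounds the norm of the product of
    scalars by 1, and a unit sequence shows that 1 is attained.  The ideal
    inequality composes [induced_norm_le] with the bounds that linear stability
    gives for the linear operators. *)

Set Implicit Arguments.
Unset Strict Implicit.
Unset Printing Implicit Defensive.

Import Order.TTheory GRing.Theory Num.Theory.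
Import numFieldNormedType.Exports.

Local Open Scope classical_set_scope.
Local Open Scope ring_scope.

Arguments seq_norm {R k} X {E} x : rename.

(** * The real-valued norm of a module over the ground field *)

Section RealNorm.
Variables (R : realType) (k : field_kind).
Local Notation K := (ground_field R k).
Local Notation KB := (ground_banach R k).

(** The inclusion of the reals in the ground field, a section of [ground_re].
    It serves to scale vectors by a real factor, and to translate the
    inequalities between the norms of the modules, which live in the ground
    field, into inequalities between the reals [rnorm x]. *)
Definition ground_inj : R -> K :=
  match k return R -> ground_field R k with
  | RealField => fun x => x
  | ComplexField => fun x => (x%:C)%C
  end.

Lemma ground_reK : cancel ground_inj (@ground_re R k).
Proof. by rewrite /ground_inj /ground_re; case: k. Qed.

Lemma ler_ground_inj : {mono ground_inj : x y / x <= y}.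
Proof. by rewrite /ground_inj; case: k => x y //; rewrite lecR. Qed.

Lemma ltr_ground_inj : {mono ground_inj : x y / x < y}.
Proof. by rewrite /ground_inj; case: k => x y //; rewrite ltcR. Qed.

Lemma ground_re_ge0K (a : K) : 0 <= a -> ground_inj (ground_re a) = a.
Proof.
rewrite /ground_inj /ground_re; case: k a => //= -[x y].
by rewrite lecE /= => /andP[/eqP -> _].
Qed.

Lemma ground_injD x y : ground_inj (x + y) = ground_inj x + ground_inj y.
Proof. by rewrite /ground_inj; case: k => //; rewrite rmorphD. Qed.

Lemma ground_injM x y : ground_inj (x * y) = ground_inj x * ground_inj y.
Proof. by rewrite /ground_inj; case: k => //; rewrite rmorphM. Qed.

Lemma ground_inj0 : ground_inj 0 = 0.
Proof. by rewrite /ground_inj; case: k. Qed.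

Lemma ground_inj1 : ground_inj 1 = 1.
Proof. by rewrite /ground_inj; case: k. Qed.

Lemma norm_rnorm (V : normedModType K) (x : V) : `|x| = ground_inj (rnorm x).
Proof. by rewrite ground_re_ge0K. Qed.

Lemma ground_inj_inj : injective ground_inj.
Proof. exact: can_inj ground_reK. Qed.

Lemma rnorm_ge0 (V : normedModType K) (x : V) : 0 <= rnorm x.
Proof. by rewrite -ler_ground_inj -norm_rnorm ground_inj0. Qed.

Lemma rnorm0 (V : normedModType K) : rnorm (0 : V) = 0.
Proof. by apply: ground_inj_inj; rewrite -norm_rnorm normr0 ground_inj0. Qed.

Lemma rnorm0_eq0 (V : normedModType K) (x : V) : rnorm x = 0 -> x = 0.
Proof. by move=> x0; apply/normr0_eq0; rewrite norm_rnorm x0 ground_inj0. Qed.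

Lemma rnormN (V : normedModType K) (x : V) : rnorm (- x) = rnorm x.
Proof. by apply: ground_inj_inj; rewrite -!norm_rnorm normrN. Qed.

Lemma rnormB (V : normedModType K) (x y : V) : rnorm (x - y) = rnorm (y - x).
Proof. by rewrite -rnormN opprB. Qed.

Lemma rnormD (V : normedModType K) (x y : V) :
  rnorm (x + y) <= rnorm x + rnorm y.
Proof. by rewrite -ler_ground_inj ground_injD -!norm_rnorm ler_normD. Qed.

Lemma rnormZ (V : normedModType K) (a : K) (x : V) :
  rnorm (a *: x) = rnorm (a : KB) * rnorm x.
Proof.
by apply: ground_inj_inj; rewrite ground_injM -!norm_rnorm normrZ.
Qed.

Lemma rnormM (a b : K) : rnorm (a * b : KB) = rnorm (a : KB) * rnorm (b : KB).
Proof. exact: (@rnormZ KB). Qed.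

Lemma rnorm1 : rnorm (1 : KB) = 1.
Proof.
apply: ground_inj_inj; rewrite -norm_rnorm ground_inj1.
exact: (@normr1 K).
Qed.

Lemma rnorm_inj (r : R) : 0 <= r -> rnorm (ground_inj r : KB) = r.
Proof.
move=> r0; apply: ground_inj_inj; rewrite -norm_rnorm.
by apply: (@ger0_norm K); rewrite -ground_inj0 ler_ground_inj.
Qed.

Lemma cvg_rnormP (V : normedModType K) (T : Type) (F : set_system T)
    (FF : Filter F) (f : T -> V) (l : V) :
  f x @[x --> F] --> l <->
  forall e : R, 0 < e -> \forall x \near F, rnorm (f x - l) < e.
Proof.
split=> [/cvgrPdist_lt fl e e0|fl].
  have /fl : 0 < ground_inj e by rewrite -ground_inj0 ltr_ground_inj.
  by apply: filterS => x; rewrite distrC norm_rnorm ltr_ground_inj.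
apply/cvgrPdist_lt => e e0; rewrite -(ground_re_ge0K (ltW e0)).
have /fl : 0 < ground_re e.
  by rewrite -ltr_ground_inj ground_inj0 ground_re_ge0K// ltW.
by apply: filterS => x; rewrite distrC norm_rnorm ltr_ground_inj.
Qed.

End RealNorm.

(** * Baire category and uniform boundedness for a complete norm *)

Lemma exists_half_expn_lt (R : realType) (e : R) :
  0 < e -> exists i, (2^-1) ^+ i < e.
Proof.
move=> e0; exists (Num.truncn e^-1).+1.
rewrite exprVn invf_plt ?posrE ?exprn_gt0//.
apply: lt_trans (truncnS_gt _) _.
by rewrite -natrX ltr_nat ltn_expl.
Qed.

Section CompleteNorm.
Variables (R : realType) (k : field_kind).
Local Notation K := (ground_field R k).
Local Notation KB := (ground_banach R k).
Variables (V : lmodType K) (S : set V) (N : V -> R) (SN : complete_norm S N).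

Lemma cn_spaceD x y : S x -> S y -> S (x + y).
Proof. by move=> Sx Sy; rewrite -[x]scale1r; exact: (cn_subspaceP SN). Qed.

Lemma cn_spaceZ (a : K) x : S x -> S (a *: x).
Proof.
move=> Sx; rewrite -[_ *: _]addr0; apply: (cn_subspaceP SN) => //.
exact: cn_subspace0 SN.
Qed.

Lemma cn_spaceN x : S x -> S (- x).
Proof. by move=> Sx; rewrite -scaleN1r; exact: cn_spaceZ. Qed.

Lemma cn_spaceB x y : S x -> S y -> S (x - y).
Proof. by move=> Sx Sy; apply: cn_spaceD => //; exact: cn_spaceN. Qed.

Lemma cn_space_sum (I : Type) (r : seq I) (u : I -> V) :
  (forall i, S (u i)) -> S (\sum_(i <- r) u i).
Proof.
move=> Su; elim/big_rec: _ => [|i x _]; first exact: cn_subspace0 SN.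
exact: cn_spaceD.
Qed.

Lemma cn_norm0 : N 0 = 0.
Proof.
rewrite -[in LHS](scale0r 0) (cn_homog SN) ?rnorm0 ?mul0r//.
exact: cn_subspace0 SN.
Qed.

Lemma cn_normN x : S x -> N (- x) = N x.
Proof.
move=> Sx; rewrite -scaleN1r (cn_homog SN)//.
by rewrite (rnormN (1 : KB)) rnorm1 mul1r.
Qed.

Lemma cn_distC x y : S x -> S y -> N (x - y) = N (y - x).
Proof. by move=> Sx Sy; rewrite -cn_normN ?opprB//; exact: cn_spaceB. Qed.

Lemma cn_dist_triangle z x y :
  S x -> S y -> S z -> N (x - y) <= N (x - z) + N (z - y).
Proof.
move=> Sx Sy Sz; rewrite -[in leLHS](subrK z x) -addrA.
by apply: (cn_triangle SN); exact: cn_spaceB.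
Qed.

Lemma cn_norm_sum (r : seq nat) (u : nat -> V) :
  (forall i, S (u i)) -> N (\sum_(i <- r) u i) <= \sum_(i <- r) N (u i).
Proof.
move=> Su; elim: r => [|i r IH]; first by rewrite !big_nil cn_norm0.
rewrite !big_cons; apply: le_trans (cn_triangle SN (Su _) (cn_space_sum _ Su)) _.
by rewrite lerD2l.
Qed.

(** Baire category: if no [P j] were dense in any ball, one could choose nested
    balls of radius tending to zero, the one with index [j.+1] missing [P j];
    by completeness their centres converge to a point that lies in no [P j]. *)
Lemma complete_norm_baire (P : nat -> set V) :
    (forall x, S x -> exists j, P j x) ->
  exists (j : nat) (x0 : V) (r : R), [/\ S x0, 0 < r &
    forall y, S y -> N (y - x0) < r -> forall e : R, 0 < e ->
      exists u, [/\ S u, P j u & N (y - u) < e]].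
Proof.
move=> Pcover; apply: contrapT => Pno.
(* A pair is a ball, given by its centre and its radius. *)
pose ok (b : V * R) := S b.1 /\ 0 < b.2.
pose inner j (b b' : V * R) :=
  [/\ ok b', b'.2 <= b.2 / 2, N (b'.1 - b.1) + b'.2 <= b.2
    & forall u, S u -> N (b'.1 - u) <= b'.2 -> ~ P j u].
have step (jb : nat * (V * R)) : exists b', ok jb.2 -> inner jb.1 jb.2 b'.
  case: jb => j b /=.
  case: (pselect (ok b)) => [[Sb b0]|nb]; last by exists b.
  have [y [e [Sy yb e0 He]]] : exists (y : V) (e : R),
      [/\ S y, N (y - b.1) < b.2, 0 < e &
         forall u, S u -> N (y - u) < e -> ~ P j u].
    apply: contrapT => H; apply: Pno; exists j, b.1, b.2.
    split => // y Sy yb e e0.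
    apply: contrapT => H2; apply: H; exists y, e; split => // u Su yu Pu.
    by apply: H2; exists u.
  exists (y, Num.min (e / 2) (Num.min (b.2 - N (y - b.1)) (b.2 / 2))) => _ /=.
  split.
  - by split => //; rewrite !lt_min !divr_gt0//= subr_gt0 yb.
  - by rewrite !ge_min lexx !orbT.
  - by rewrite addrC -lerBrDr !ge_min lexx !orbT.
  - move=> u Su yu; apply: He => //; apply: le_lt_trans yu _.
    by rewrite gt_min ltr_pdivrMr// ltr_pMr// ltr1n.
have /choice[g Hg] := step; pose f j b := g (j, b).
have Hf j b : ok b -> inner j b (f j b) by exact: (Hg (j, b)).
pose b := fix b j := if j is j'.+1 then f j' (b j') else (0 : V, 1 : R).
have bok j : ok (b j).
  elim: j => [|j IH]; first by split => //; exact: cn_subspace0 SN.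
  by have [] := Hf j _ IH.
have bS j := (bok j).1.
have bhalf j : (b j).2 <= (2^-1) ^+ j.
  elim: j => [|j IH]; first by rewrite expr0.
  have [_ h _ _] := Hf j _ (bok j); rewrite exprSr.
  by apply: le_trans h _; rewrite ler_pM2r.
have bnest i d : N ((b (d + i)%N).1 - (b i).1) + (b (d + i)%N).2 <= (b i).2.
  elim: d => [|d IH]; first by rewrite add0n subrr cn_norm0 add0r.
  have [_ _ h _] := Hf (d + i)%N (b (d + i)%N) (bok (d + i)%N); rewrite addSn.
  apply: le_trans IH.
  have := @cn_dist_triangle (b (d + i)%N).1 (b (d + i).+1).1 (b i).1
    (bS _) (bS _) (bS _).
  rewrite /= in h *; lra.
have bdist i j : (i <= j)%N -> N ((b j).1 - (b i).1) <= (b i).2.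
  move=> /subnK <-; have := bnest i (j - i)%N.
  by have := (bok (j - i + i)%N).2; lra.
have [e e0|l Sl bl] := @cn_complete _ _ _ _ _ SN (fun j => (b j).1) bS.
  have [i ie] := exists_half_expn_lt (divr_gt0 e0 (ltr0n _ 2)).
  exists i => p q ip iq.
  apply: le_lt_trans (cn_dist_triangle (bS p) (bS q) (bS i)) _.
  rewrite (cn_distC (bS i))//.
  have := bdist _ _ ip; have := bdist _ _ iq; have := bhalf i; lra.
have lb i : N ((b i).1 - l) <= (b i).2.
  apply/ler_addgt0Pr => e e0.
  have /cvgrPdist_lt/(_ _ e0)[m _ Hm] := bl.
  have := Hm (maxn m i) (leq_maxl _ _).
  rewrite /= sub0r normrN ger0_norm; last first.
    by apply: (cn_ge0 SN); exact: cn_spaceB.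
  have := bdist _ _ (leq_maxr m i).
  have := cn_dist_triangle (bS i) Sl (bS (maxn m i)).
  rewrite (cn_distC (bS i) (bS (maxn m i))); lra.
have [j Pj] := Pcover l Sl.
by have [_ _ _ /(_ l Sl (lb j.+1))] := Hf j _ (bok j).
Qed.

(** Countably subadditive seminorms: [p x] is at most the sum of the [p (u l)]
    whenever [x] is the sum of the series of the [u l].  The field [ss_series]
    expresses the sum by its upper bounds [c], so that a divergent sum imposes
    nothing. *)
Record sigma_seminorm (p : V -> R) : Prop := {
  ss_homog : forall (a : K) x, S x -> p (a *: x) = rnorm (a : KB) * p x;
  ss_add : forall x y, S x -> S y -> p (x + y) <= p x + p y;
  ss_series : forall (u : nat -> V) x c, (forall j, S (u j)) -> S x ->
    N (x - \sum_(0 <= l < j) u l) @[j --> \oo] --> (0 : R) ->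
    (forall j, \sum_(0 <= l < j) p (u l) <= c) -> p x <= c
}.

(** Zabreiko's lemma for a family.  By Baire, the set where all [q i] are at
    most some [j] is dense in a ball, hence (taking differences) the set where
    they are at most [M = 2 j] is dense in a ball centred at the origin.  A
    vector of that ball is then the sum of a series whose terms satisfy the
    bounds [M], [M / 2], [M / 4], ..., each term approximating what the
    previous ones leave; countable subadditivity turns these bounds into
    [2 M]. *)
Lemma sigma_seminorm_uniform_bounded (I : Type) (q : I -> V -> R) :
    (forall i, sigma_seminorm (q i)) ->
    (forall x, S x -> exists C, forall i, q i x <= C) ->
  exists C, forall x, S x -> N x <= 1 -> forall i, q i x <= C.
Proof.
move=> qs qb.
have [x Sx|j [x0 [r [Sx0 r0 Hr]]]] := @complete_norm_baire
    (fun j => [set x | forall i, q i x <= j%:R]).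
  have [C HC] := qb x Sx; exists (Num.truncn C).+1 => i /=.
  by apply: le_trans (HC i) _; rewrite ltW// truncnS_gt.
pose M : R := j%:R + j%:R.
have approx x e : S x -> N x < r -> 0 < e ->
    exists u, [/\ S u, N (x - u) < e & forall i, q i u <= M].
  move=> Sx xr e0; have e20 : 0 < e / 2 by rewrite divr_gt0.
  have [|u [Su qu xu]] := Hr (x0 + x) (cn_spaceD Sx0 Sx) _ _ e20.
    by rewrite addrAC subrr add0r.
  have [|v [Sv qv xv]] := Hr x0 Sx0 _ _ e20.
    by rewrite subrr cn_norm0.
  exists (u - v); split; first exact: cn_spaceB.
    have -> : x - (u - v) = (x0 + x - u) - (x0 - v).
      by rewrite !opprB -(addrA x0) [RHS]addrC subrKA addrCA.
    have := cn_triangle SN (cn_spaceB (cn_spaceD Sx0 Sx) Su)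
      (cn_spaceN (cn_spaceB Sx0 Sv)).
    rewrite cn_normN; [lra|exact: cn_spaceB].
  move=> i; apply: le_trans (ss_add (qs i) Su (cn_spaceN Sv)) _.
  rewrite -[- v]scaleN1r (ss_homog (qs i))// (rnormN (1 : KB)) rnorm1 mul1r.
  by apply: lerD; [exact: qu|exact: qv].
have approx_scaled (mx : nat * V) : exists u,
    S mx.2 -> N mx.2 < r * (2^-1) ^+ mx.1 ->
    [/\ S u, N (mx.2 - u) < r * (2^-1) ^+ mx.1.+1
      & forall i, q i u <= M * (2^-1) ^+ mx.1].
  case: mx => m x /=.
  case: (pselect (S x /\ N x < r * (2^-1) ^+ m)) => [[Sx xr]|nx]; last first.
    by exists 0 => ? ?; case: nx.
  have h0 p : 0 < 2^-1 ^+ p :> R by rewrite exprn_gt0.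
  pose a : K := ground_inj k (2 ^+ m); pose b : K := ground_inj k (2^-1 ^+ m).
  have ba : b * a = 1.
    by rewrite /b /a -ground_injM exprVn mulVf ?expf_neq0// ground_inj1.
  have ra : rnorm (a : KB) = 2 ^+ m by rewrite rnorm_inj.
  have rb : rnorm (b : KB) = 2^-1 ^+ m by rewrite rnorm_inj// ltW.
  have [|u [Su xu qu]] := @approx (a *: x) (r / 2) (cn_spaceZ a Sx) _
      (divr_gt0 r0 (ltr0n _ 2)).
    by rewrite (cn_homog SN)// ra mulrC -ltr_pdivlMr ?exprn_gt0// -exprVn.
  exists (b *: u) => _ _; split; first exact: cn_spaceZ.
    rewrite -{1}[x]scale1r -ba -scalerA -scalerBr (cn_homog SN) ?rb.
      by rewrite exprSr mulrA [r * _]mulrC -mulrA ltr_pM2l.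
    exact: cn_spaceB (cn_spaceZ _ _) _.
  by move=> i; rewrite (ss_homog (qs i))// rb mulrC ler_pM2r.
have /choice[g Hg] := approx_scaled; pose f m x := g (m, x).
have Hf m x : S x -> N x < r * (2^-1) ^+ m ->
    [/\ S (f m x), N (x - f m x) < r * (2^-1) ^+ m.+1
      & forall i, q i (f m x) <= M * (2^-1) ^+ m] by exact: (Hg (m, x)).
have M0 : 0 <= M by rewrite /M addr_ge0.
have small x : S x -> N x < r -> forall i, q i x <= M + M.
  move=> Sx xr i.
  (* [y m] is the remainder of [x] after [m] terms of the series. *)
  pose y := fix y m := if m is m'.+1 then y m' - f m' (y m') else x.
  have yok m : S (y m) /\ N (y m) < r * (2^-1) ^+ m.
    elim: m => [|m [Sy yr]]; first by rewrite expr0 mulr1.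
    have [Sf fr _] := Hf m _ Sy yr; split => //.
    exact: cn_spaceB.
  have fok m := Hf m _ (yok m).1 (yok m).2.
  have ysum m : x - \sum_(0 <= l < m) f l (y l) = y m.
    elim: m => [|m IH]; first by rewrite big_nil subr0.
    by rewrite big_nat_recr//= opprD addrA IH.
  apply: (ss_series (qs i) (u := fun m => f m (y m))) => //.
  - by move=> m; have [] := fok m.
  - under eq_fun do rewrite ysum.
    apply/cvgrPdist_lt => e e0.
    have [m0 me] := exists_half_expn_lt (divr_gt0 e0 r0).
    exists m0 => // m /= m0m; rewrite sub0r normrN ger0_norm; last first.
      by apply: (cn_ge0 SN); have [] := yok m.
    apply: lt_trans (yok m).2 _; rewrite mulrC -ltr_pdivlMr//.
    by apply: le_lt_trans me; apply: ler_wiXn2l => //; rewrite invf_le1 ?ler1n.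
  - move=> m.
    suff : \sum_(0 <= l < m) q i (f l (y l)) <= (M + M) * (1 - (2^-1) ^+ m).
      by move=> /le_trans; apply; rewrite ler_piMr ?addr_ge0//.
    elim: m => [|m IH]; first by rewrite big_nil expr0 subrr mulr0.
    rewrite big_nat_recr//= exprSr; have [_ _ /(_ i)] := fok m.
    move: IH; set s := \sum_(_ <= _ < _) _; set h := _ ^+ m; set w := q _ _.
    by lra.
exists (2 / r * (M + M)) => x Sx x1 i.
pose a : K := ground_inj k (r / 2); pose b : K := ground_inj k (2 / r).
have ba : b * a = 1.
  by rewrite /b /a -ground_injM mulrA divfK ?gt_eqF// mulfV// ground_inj1.
rewrite -[x]scale1r -ba -scalerA (ss_homog (qs i)); last exact: cn_spaceZ.
rewrite rnorm_inj ?divr_ge0// ?(ltW r0)// ler_pM2l ?divr_gt0//.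
apply: small; first exact: cn_spaceZ.
rewrite (cn_homog SN)// rnorm_inj ?divr_ge0// ?(ltW r0)//.
have := ler_pM2l (divr_gt0 r0 (ltr0n R 2)) (N x) 1; rewrite x1 mulr1.
by move=> /le_lt_trans; apply; lra.
Qed.

End CompleteNorm.

(** * Homogeneity and closed graphs *)

Lemma sup_ge0 (R : realType) (A : set R) :
  (forall x, A x -> 0 <= x) -> 0 <= sup A.
Proof.
move=> A0; case: (pselect (has_sup A)) => [sA|/sup_out ->//].
have [[x Ax] bA] := sA; exact: le_trans (A0 _ Ax) (ub_le_sup bA Ax).
Qed.

Section ClosedGraph.
Variables (R : realType) (k : field_kind).
Local Notation K := (ground_field R k).
Local Notation KB := (ground_banach R k).
Variables (V : lmodType K) (S : set V) (N : V -> R) (SN : complete_norm S N).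

(** A vector of norm zero is also a multiple of a vector of the unit ball,
    namely of the zero vector: this lets homogeneity arguments proceed without
    separating the case of a vanishing norm. *)
Lemma cn_normalize x : S x ->
  exists y, [/\ S y, N y <= 1 & x = ground_inj k (N x) *: y].
Proof.
move=> Sx; have [x0|x0] := eqVneq (N x) 0.
  exists 0; split; first exact: cn_subspace0 SN.
    by rewrite (cn_norm0 SN).
  by rewrite scaler0; apply: (cn_eq0 SN).
have Nx0 : 0 <= (N x)^-1 by rewrite invr_ge0 (cn_ge0 SN).
exists (ground_inj k (N x)^-1 *: x); split; first exact: (cn_spaceZ SN).
  by rewrite (cn_homog SN)// rnorm_inj// mulVf.
by rewrite scalerA -ground_injM mulfV// ground_inj1 scale1r.
Qed.

Lemma homog_bound (p : V -> R) C :
    (forall (a : K) x, S x -> p (a *: x) = rnorm (a : KB) * p x) ->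
    (forall x, S x -> N x <= 1 -> p x <= C) ->
  forall x, S x -> p x <= C * N x.
Proof.
move=> pZ pC x Sx; have [y [Sy y1 xy]] := cn_normalize Sx.
have Nx0 : 0 <= N x by apply: (cn_ge0 SN).
by rewrite {1}xy pZ// rnorm_inj// mulrC; apply: ler_wpM2r => //; exact: pC.
Qed.

Variables (W : lmodType K) (S' : set W) (N' : W -> R).
Variable SN' : complete_norm S' N'.

(** If [x] is the sum of the [u l] and the sum of the [N' (T (u l))] is finite,
    then the series of the [T (u l)] converges absolutely, hence converges by
    completeness of the target, and the closed graph identifies its sum with
    [T x]. *)
Lemma closed_graph_sigma_seminorm (T : V -> W) : linear T ->
    (forall x, S x -> S' (T x)) ->
    (forall (u : nat -> V) x y, (forall j, S (u j)) -> S x -> S' y ->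
      N (x - u j) @[j --> \oo] --> (0 : R) ->
      N' (T (u j) - y) @[j --> \oo] --> (0 : R) -> T x = y) ->
  sigma_seminorm S N (N' \o T).
Proof.
move=> Tlin TS Tclosed.
pose TL : {linear V -> W} := HB.pack T (GRing.isLinear.Build _ _ _ _ _ Tlin).
have TZ a x : T (a *: x) = a *: T x by exact: (linearZZ TL).
have TD x y : T (x + y) = T x + T y by exact: (linearD TL).
have TB x y : T (x - y) = T x - T y by exact: (linearB TL).
have Tsum (r : seq nat) u : T (\sum_(l <- r) u l) = \sum_(l <- r) T (u l).
  exact: (linear_sum TL).
split => [a x Sx|x y Sx Sy|u x c Su Sx ux uc] /=.
- by rewrite TZ (cn_homog SN')//; exact: TS.
- by rewrite TD; apply: (cn_triangle SN'); exact: TS.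
pose v j := \sum_(0 <= l < j) u l.
have Sv j : S (v j) by exact: (cn_space_sum SN).
pose s j := \sum_(0 <= l < j) N' (T (u l)).
have vs i d : N' (T (v (i + d)%N) - T (v i)) <= s (i + d)%N - s i.
  rewrite /s [in leRHS](big_cat_nat (n := i))//= ?leq_addr//.
  rewrite addrAC subrr add0r -TB /v (big_cat_nat (n := i) (m := 0))//= ?leq_addr//.
  by rewrite addrAC subrr add0r Tsum; apply: (cn_norm_sum SN') => l; exact: TS.
have s_nd : nondecreasing_seq s.
  apply/nondecreasing_seqP => j; rewrite /s big_nat_recr//= lerDl.
  by apply: (cn_ge0 SN'); exact: TS.
have s_cvg : cvgn s.
  by apply: nondecreasing_is_cvgn => //; exists c => _ [j _ <-]; exact: uc.
have [e e0|y Sy yl] := @cn_complete _ _ _ _ _ SN' (fun j => T (v j))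
  (fun j => TS _ (Sv j)).
  have /cvgrPdist_lt/(_ _ (divr_gt0 e0 (ltr0n _ 2)))[i0 _ Hi] := s_cvg.
  have H i j : (i0 <= i)%N -> (i <= j)%N -> N' (T (v j) - T (v i)) < e.
    move=> i0i ij; have := vs i (j - i)%N.
    rewrite subnKC// => /le_lt_trans; apply.
    have := Hi _ i0i; have := Hi _ (leq_trans i0i ij); rewrite /=.
    by rewrite !ltr_norml => /andP[? ?] /andP[? ?]; lra.
  exists i0 => i j i0i i0j; case: (leqP i j) => [ij|/ltnW ji]; last exact: H.
  by rewrite (cn_distC SN'); [exact: H|exact: TS|exact: TS].
rewrite (Tclosed v x y)//; apply/ler_addgt0Pr => e e0.
have /cvgrPdist_lt/(_ _ e0)[j _ /(_ j (leqnn _))] := yl.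
rewrite /= sub0r normrN ger0_norm; last first.
  by apply: (cn_ge0 SN'); apply: (cn_spaceB SN') => //; exact: TS.
have := cn_dist_triangle SN' Sy (cn_subspace0 SN') (TS _ (Sv j)).
rewrite !subr0 (cn_distC SN' Sy (TS _ (Sv j))).
have : N' (T (v j)) <= c.
  apply: le_trans (uc j); rewrite /v Tsum.
  by apply: (cn_norm_sum SN') => l; exact: TS.
lra.
Qed.

End ClosedGraph.

(** * Sequence classes *)

Section SequenceClass.
Variables (R : realType) (k : field_kind).
Local Notation K := (ground_field R k).
Local Notation KB := (ground_banach R k).
Local Notation banach := (completeNormedModType K).
Variable X : sequence_class R k.
Implicit Types E F : banach.

Lemma coord_le_seq_norm E (x : nat -> E) j :
  X E x -> rnorm (x j) <= seq_norm X x.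
Proof.
move=> Xx; have [bx] := seq_linfty Xx; apply: le_trans.
by apply: ub_le_sup => //; exists j.
Qed.

Lemma seq_norm_cvg_coord E (T : Type) (G : set_system T) {GF : Filter G}
    (u : T -> nat -> E) (x : nat -> E) :
    (forall t, X E (u t)) -> X E x ->
    seq_norm X (u t - x) @[t --> G] --> (0 : R) ->
  forall j, u t j @[t --> G] --> x j.
Proof.
move=> Xu Xx ux j; apply/cvg_rnormP => e e0.
move/cvgrPdist_lt: ux => /(_ _ e0); apply: filterS => t.
rewrite sub0r normrN; apply: le_lt_trans.
have Xux : X E (u t - x) by exact: (cn_spaceB (seq_banach X E)).
rewrite ger0_norm; first exact: (coord_le_seq_norm j Xux).
by apply: (cn_ge0 (seq_banach X E)).
Qed.

Lemma opnorm_ge0 E F (u : E -> F) : 0 <= opnorm u.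
Proof. by apply: sup_ge0 => _ [x _ <-]; exact: rnorm_ge0. Qed.

Hypothesis X_stable : linearly_stable X.

Lemma stable_space E F (u : {linear E -> F}) x :
  continuous u -> X E x -> X F (u \o x).
Proof. by move=> cu; have [uX _ _] := X_stable cu; exact: uX. Qed.

Lemma stable_norm_le E F (u : {linear E -> F}) x : continuous u -> X E x ->
  seq_norm X (u \o x) <= opnorm u * seq_norm X x.
Proof.
move=> cu; have [uX ub us] := X_stable cu.
apply: (homog_bound (seq_banach X E) (p := fun x => seq_norm X (u \o x)))
  => [a y Xy|y Xy y1].
  rewrite -(cn_homog (seq_banach X F)); last exact: uX.
  by congr seq_norm; apply/funext => j /=; rewrite linearZ.
by rewrite -us; apply: ub_le_sup => //; exists y.
Qed.

Definition scale_vector E (b : E) (a : KB) : E := (a : K) *: b.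

Lemma scale_vector_linear E (b : E) : linear (scale_vector b).
Proof. by move=> c x y; rewrite /scale_vector scalerDl scalerA. Qed.

HB.instance Definition _ E (b : E) :=
  GRing.isLinear.Build K KB E *:%R (scale_vector b) (scale_vector_linear b).

Lemma scale_vector_opnorm_le E (b : E) : opnorm (scale_vector b) <= rnorm b.
Proof.
apply: ge_sup.
  by exists (rnorm (scale_vector b 0)); exists 0 => //=; rewrite rnorm0.
by move=> _ [a a1 <-]; rewrite rnormZ ler_piMl// rnorm_ge0.
Qed.
Lemma scale_vector_continuous E (b : E) : continuous (scale_vector b).
Proof. exact: scalel_continuous. Qed.

(** Written as the image of a scalar sequence under a linear operator, since
    this is what linear stability speaks of. *)
Definition single_seq E (b : E) : nat -> E := scale_vector b \o unit_seq R k 0.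

Lemma unit_seq_space j : X KB (unit_seq R k j).
Proof.
by apply: seq_c00; exists j.+1 => i ji; rewrite /unit_seq gtn_eqF.
Qed.

Lemma single_seq_space E (b : E) : X E (single_seq b).
Proof.
by apply: stable_space; [exact: scale_vector_continuous|exact: unit_seq_space].
Qed.

Lemma single_seq_norm_le E (b : E) : seq_norm X (single_seq b) <= rnorm b.
Proof.
apply: le_trans
  (stable_norm_le (@scale_vector_continuous E b) (unit_seq_space 0)) _.
by rewrite seq_canon mulr1 scale_vector_opnorm_le.
Qed.

Lemma single_seq0 E (b : E) : single_seq b 0 = b.
Proof. by rewrite /single_seq /= /scale_vector /unit_seq eqxx scale1r. Qed.

End SequenceClass.

(** * Boundedness of the induced operator *)

Lemma dfwith_id (I : eqType) (T : I -> Type) (f : forall i, T i) i :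
  dfwith f i (f i) = f.
Proof. by apply: functional_extensionality_dep => j; case: dfwithP. Qed.

Lemma dfwith_apply (I : eqType) (T : I -> Type) (D : Type)
    (f : forall i, D -> T i) i (y : D -> T i) d :
  (fun j => dfwith f i y j d) = dfwith (fun j => f j d) i (y d).
Proof.
apply: functional_extensionality_dep => j.
by case: (dfwithP f y) => [|l il]; rewrite ?dfwithin// dfwithout.
Qed.

Section Induced.
Variables (R : realType) (k : field_kind) (n : nat).
Local Notation K := (ground_field R k).
Local Notation KB := (ground_banach R k).
Local Notation banach := (completeNormedModType K).
Implicit Types (E : 'I_n -> banach) (F : banach).

Lemma multilinear_homog E F (A : (forall m, E m) -> F) (c : 'I_n -> K) x :
  multilinear A -> A (fun m => c m *: x m) = (\prod_m c m) *: A x.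
Proof.
move=> Am.
have AZ z m (a : K) (y : E m) : A (dfwith z m (a *: y)) = a *: A (dfwith z m y).
  pose L : {linear E m -> F} := HB.pack (fun y => A (dfwith z m y))
    (GRing.isLinear.Build _ _ _ _ _ (Am z m)).
  exact: (linearZZ L).
suff H (s : seq 'I_n) : uniq s ->
    A (fun m => if m \in s then c m *: x m else x m) =
    (\prod_(m <- s) c m) *: A x.
  rewrite -(H (index_enum _) (index_enum_uniq _)); congr A.
  by apply: functional_extensionality_dep => m; rewrite mem_index_enum.
elim: s => [_|i s IH /= /andP[iNs us]].
  by rewrite big_nil scale1r; congr A; apply: functional_extensionality_dep.
pose z m := if m \in s then c m *: x m else x m.
have -> : (fun m => if m \in i :: s then c m *: x m else x m) =
    dfwith z i (c i *: x i).
  apply: functional_extensionality_dep => m.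
  case: (dfwithP z (c i *: x i)) => [|j ij].
    by rewrite inE eqxx.
  by rewrite inE eq_sym (negbTE ij).
rewrite AZ big_cons -scalerA -IH//; congr (_ *: A _).
have -> : x i = z i by rewrite /z (negbTE iNs).
exact: dfwith_id.
Qed.

Lemma cmultilinear_continuous_coord E F (A : (forall m, E m) -> F) x m :
  cmultilinear A -> continuous (fun y : E m => A (dfwith x m y)).
Proof.
move=> [_ Ac] y.
apply: (@continuous_comp _ (prod_topology E) _ (@dfwith _ _ x m) A).
  exact: (@dfwith_continuous _ E x m).
exact: Ac.
Qed.

Variables (X : 'I_n -> sequence_class R k) (Y : sequence_class R k).

(** The graph is closed because convergence in [X m] and in [Y] implies
    convergence of the coordinates, where [A] is continuous. *)
Lemma induced_sigma_seminorm E F (A : (forall m, E m) -> F)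
    (z : forall m, nat -> E m) m :
    L_class X Y A -> (forall i, X i (E i) (z i)) ->
  sigma_seminorm (X m (E m)) (seq_norm (X m) (E := E m))
    (fun w => seq_norm Y (induced A (dfwith z m w))).
Proof.
move=> [Acm AXY] Xz.
have Xdf w : X m (E m) w -> forall i, X i (E i) (dfwith z m w i).
  by move=> Xw i; case: dfwithP.
have indE w j :
    induced A (dfwith z m w) j = A (dfwith (fun i => z i j) m (w j)).
  by rewrite /induced dfwith_apply.
apply: (closed_graph_sigma_seminorm (seq_banach (X m) (E m)) (seq_banach Y F)
  (T := fun w => induced A (dfwith z m w))).
- move=> a v w; apply/funext => j; rewrite !indE.
  rewrite -[RHS]/(a *: induced A (dfwith z m v) j
    + induced A (dfwith z m w) j) !indE.
  exact: Acm.1.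
- by move=> w Xw; apply: AXY; exact: Xdf.
- move=> u x y Xu Xx Yy ux uy; apply/funext => j.
  have Yind w : X m (E m) w -> Y F (induced A (dfwith z m w)).
    by move=> Xw; apply: AXY; exact: Xdf.
  have := seq_norm_cvg_coord (fun i => Yind _ (Xu i)) Yy uy (j := j).
  have ujx : u i j @[i --> \oo] --> x j.
    apply: (seq_norm_cvg_coord (X := X m)) => //.
    by under eq_fun do rewrite (cn_distC (seq_banach _ _))//.
  have : A (dfwith (fun i => z i j) m (u i j)) @[i --> \oo] -->
      A (dfwith (fun i => z i j) m (x j)).
    have Aj := @cmultilinear_continuous_coord E F A (fun i => z i j) m Acm.
    exact (cvg_comp _ _ ujx (Aj (x j))).
  under eq_fun do rewrite -indE.
  rewrite -indE => Tx Ty.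
  have {}Ty := Ty eventually_filter.
  exact (cvg_unique (@norm_hausdorff K F) Tx Ty).
Qed.

(** Induction on the number [p] of variables that range over unit balls, the
    others being fixed.  To release one more, these [p] variables index a
    family of countably subadditive seminorms in the next one, and the
    induction hypothesis, with the next variable fixed, is the pointwise
    boundedness of this family. *)
Lemma induced_bounded E F (A : (forall m, E m) -> F) : L_class X Y A ->
  exists C, forall x : forall m, nat -> E m,
    (forall m, X m (E m) (x m) /\ seq_norm (X m) (x m) <= 1) ->
    seq_norm Y (induced A x) <= C.
Proof.
move=> LA.
suff H p : (p <= n)%N -> forall x : forall m, nat -> E m,
    (forall m, X m (E m) (x m)) ->
    exists C, forall z : forall m, nat -> E m, (forall m, [/\ X m (E m) (z m),
      ((m < p)%N -> seq_norm (X m) (z m) <= 1) & ((p <= m)%N -> z m = x m)]) ->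
    seq_norm Y (induced A z) <= C.
  have [|C HC] := H n (leqnn n) (fun m => 0).
    by move=> m; exact: cn_subspace0 (seq_banach _ _).
  exists C => x Hx; apply: HC => m; have [Xx x1] := Hx m; split => //.
  by rewrite leqNgt ltn_ord.
elim: p => [_|p IH pn] x Xx.
  exists (seq_norm Y (induced A x)) => z Hz; rewrite (_ : z = x)//.
  by apply: functional_extensionality_dep => m; have [_ _] := Hz m; exact.
pose m := Ordinal pn.
pose I := {z : forall i, nat -> E i | forall i : 'I_n, [/\ X i (E i) (z i),
      ((i < p)%N -> seq_norm (X i) (z i) <= 1) & ((p < i)%N -> z i = x i)]}.
have [i|w Xw|C HC] := @sigma_seminorm_uniform_bounded _ _ _ _ _
  (seq_banach (X m) (E m)) I
  (fun z w => seq_norm Y (induced A (dfwith (sval z) m w))).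
- by apply: induced_sigma_seminorm => // l; have [] := svalP i l.
- have [i|C HC] := IH (ltnW pn) (dfwith x m w); first by case: dfwithP.
  exists C => z; apply: HC => i; have [Xz z1 zx] := svalP z i.
  have [mi|mi] := eqVneq m i.
    by subst i; rewrite !dfwithin; split => //; rewrite ltnn.
  rewrite !dfwithout//; split => // pi; apply: zx; rewrite ltn_neqAle pi andbT.
  by apply: contra mi => /eqP pi'; apply/eqP/val_inj.
- exists C => z Hz; have Hz' i : [/\ X i (E i) (z i),
      ((i < p)%N -> seq_norm (X i) (z i) <= 1) & ((p < i)%N -> z i = x i)].
    by have [Xz z1 zx] := Hz i; split => // ip; apply: z1; exact: ltnW.
  have [Xzm z1 _] := Hz m.
  by have := HC (z m) Xzm (z1 (ltnSn p)) (exist _ z Hz'); rewrite /= dfwith_id.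
Qed.

Lemma induced_homog E F (A : (forall m, E m) -> F) (c : 'I_n -> K)
    (x : forall m, nat -> E m) : multilinear A ->
  induced A (fun m => c m *: x m) = (\prod_m c m) *: induced A x.
Proof.
move=> Am; apply/funext => j; rewrite -[RHS]/(_ *: induced A x j) /induced.
exact: (multilinear_homog c (fun m => x m j) Am).
Qed.

Lemma rnorm_prod (c : 'I_n -> K) :
  rnorm (\prod_m c m : KB) = \prod_m rnorm (c m : KB).
Proof.
elim/big_rec2: _ => [|i y1 y2 _ <-]; first exact: rnorm1.
exact: rnormM.
Qed.

Lemma L_norm_ge0 E F (A : (forall m, E m) -> F) :
  L_class X Y A -> 0 <= L_norm X Y A.
Proof.
move=> [_ AXY]; apply: sup_ge0 => _ [x Hx <-]; apply: (cn_ge0 (seq_banach Y F)).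
by apply: AXY => m; have [] := Hx m.
Qed.

Lemma L_norm_le E F (A : (forall m, E m) -> F) C :
    (forall x : forall m, nat -> E m,
      (forall m, X m (E m) (x m) /\ seq_norm (X m) (x m) <= 1) ->
      seq_norm Y (induced A x) <= C) ->
  L_norm X Y A <= C.
Proof.
move=> A_le; apply: ge_sup; last by move=> _ [x Hx <-]; exact: A_le.
exists (seq_norm Y (induced A (fun m => 0))), (fun m => 0) => // m.
split; first exact: cn_subspace0 (seq_banach _ _).
by rewrite (cn_norm0 (seq_banach _ _)).
Qed.

Lemma induced_unit_le E F (A : (forall m, E m) -> F)
    (x : forall m, nat -> E m) :
    L_class X Y A -> (forall m, X m (E m) (x m) /\ seq_norm (X m) (x m) <= 1) ->
  seq_norm Y (induced A x) <= L_norm X Y A.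
Proof.
move=> LA Hx; have [C HC] := induced_bounded LA.
by apply: ub_le_sup; [exists C => _ [z Hz <-]; exact: HC | exists x].
Qed.

Lemma induced_norm_le E F (A : (forall m, E m) -> F)
    (x : forall m, nat -> E m) :
    L_class X Y A -> (forall m, X m (E m) (x m)) ->
  seq_norm Y (induced A x) <= L_norm X Y A * \prod_m seq_norm (X m) (x m).
Proof.
move=> LA Xx; have [[Am _] AXY] := LA.
have H m := cn_normalize (seq_banach (X m) (E m)) (Xx m).
pose y m := projT1 (cid (H m)).
have yP m : [/\ X m (E m) (y m), seq_norm (X m) (y m) <= 1 &
   x m = ground_inj k (seq_norm (X m) (x m)) *: y m] by rewrite /y; case: cid.
have x0 m : 0 <= seq_norm (X m) (x m) by apply: (cn_ge0 (seq_banach _ _)).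
pose c m := ground_inj k (seq_norm (X m) (x m)).
have -> : x = fun m => c m *: y m.
  by apply: functional_extensionality_dep => m; have [] := yP m.
rewrite induced_homog// (cn_homog (seq_banach Y F)); last first.
  by apply: AXY => m; have [] := yP m.
rewrite rnorm_prod mulrC.
have -> : \prod_m rnorm (c m : KB) = \prod_m seq_norm (X m) (x m).
  by apply: eq_bigr => m _; rewrite rnorm_inj.
have -> : \prod_m seq_norm (X m) (c m *: y m) = \prod_m seq_norm (X m) (x m).
  by apply: eq_bigr => m _; have [_ _ <-] := yP m.
apply: ler_wpM2r; first exact: prodr_ge0.
by apply: induced_unit_le => // m; have [] := yP m.
Qed.

Hypothesis X_stable : forall m, linearly_stable (X m).

(** [A x] is the first entry of the sequence induced by the [single_seq (x m)],
    whose norms are at most those of the [x m]. *)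
Lemma value_norm_le E F (A : (forall m, E m) -> F) x :
  L_class X Y A -> rnorm (A x) <= L_norm X Y A * \prod_m rnorm (x m).
Proof.
move=> LA; pose s m := single_seq (x m).
have Xs m : X m (E m) (s m) by exact: single_seq_space.
have YAs : Y F (induced A s) by exact: LA.2.
have -> : A x = induced A s 0.
  rewrite /induced; congr A; apply: functional_extensionality_dep => m.
  by rewrite /s single_seq0.
apply: le_trans (coord_le_seq_norm 0 YAs) _.
apply: le_trans (induced_norm_le LA Xs) _.
apply: ler_wpM2l; first exact: L_norm_ge0.
apply: ler_prod => m _; rewrite single_seq_norm_le// andbT.
by apply: (cn_ge0 (seq_banach _ _)).
Qed.

End Induced.

(** * Completeness *)

Section Completeness.
Variables (R : realType) (k : field_kind) (n : nat).
Local Notation K := (ground_field R k).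
Local Notation KB := (ground_banach R k).
Local Notation banach := (completeNormedModType K).
Implicit Types (E : 'I_n -> banach) (F : banach).

Lemma cvg_of_rnorm_cauchy F (v : nat -> F) :
    (forall e : R, 0 < e -> exists i0, forall i j, (i0 <= i)%N -> (i0 <= j)%N ->
       rnorm (v i - v j) < e) ->
  cvg (v @ \oo).
Proof.
move=> vC; apply: cauchy_cvg; apply: cauchy_exP => e e0.
have re0 : 0 < ground_re e.
  by rewrite -(@ltr_ground_inj R k) ground_inj0 ground_re_ge0K// ltW.
have [i0 Hi] := vC _ re0; exists (v i0), i0 => // i /= i0i.
rewrite -ball_normE /= -(ground_re_ge0K (ltW e0)) norm_rnorm ltr_ground_inj.
exact: Hi.
Qed.

Lemma rnorm_cvg_le F (T : Type) (G : set_system T) {GF : ProperFilter G}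
    (v : T -> F) l C :
  v t @[t --> G] --> l -> (\forall t \near G, rnorm (v t) <= C) -> rnorm l <= C.
Proof.
move=> vl vC; apply/ler_addgt0Pr => e e0.
have /cvg_rnormP/(_ _ e0) vle := vl.
have [t [vt le]] := filter_ex (filterI vC vle).
have := rnormD (v t) (l - v t); rewrite addrC subrK (rnormB l); lra.
Qed.

Lemma near_coord_rnorm_lt E (x0 : forall m, E m) :
  \forall x \near (x0 : prod_topology E),
    forall m, rnorm (x m) < rnorm (x0 m) + 1.
Proof.
apply (@filter_forall (prod_topology E) 'I_n
  (fun m => [set x | rnorm (x m) < rnorm (x0 m) + 1])
  (nbhs (x0 : prod_topology E)) _) => m.
have /cvg_rnormP/(_ 1 ltr01) :
    (x : prod_topology E) m @[x --> (x0 : prod_topology E)] --> x0 m.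
  exact: (@proj_continuous _ E m x0).
apply: filterS => x xx0; rewrite /=; move: xx0.
by have := rnormD (x m - x0 m) (x0 m); rewrite subrK; lra.
Qed.

Lemma cmultilinearZD E F (a : K) (A B : (forall m, E m) -> F) :
  cmultilinear A -> cmultilinear B -> cmultilinear (a *: A + B).
Proof.
move=> [Am Ac] [Bm Bc]; split => [x m c y z|x].
  rewrite -[LHS]/(a *: A _ + B _).
  rewrite -[RHS]/(c *: (a *: A _ + B _) + (a *: A _ + B _)).
  by rewrite Am Bm !scalerDr !scalerA addrACA [a * c]mulrC.
exact: (cvgD (cvgZl_tmp (k := a) (Ac x)) (Bc x)).
Qed.

(** The hypothesis says that [u] tends to [A] uniformly on bounded sets; since
    each point has a neighbourhood with bounded coordinates, the limit is
    continuous. *)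
Lemma cmultilinear_limit E F (u : nat -> (forall m, E m) -> F) A :
    (forall i, cmultilinear (u i)) ->
    (forall e : R, 0 < e -> exists i0, forall i, (i0 <= i)%N -> forall x,
       rnorm (u i x - A x) <= e * \prod_m rnorm (x m)) ->
  cmultilinear A.
Proof.
move=> um uA.
have uAx x : u i x @[i --> \oo] --> A x.
  apply/cvg_rnormP => e e0.
  have p0 : 0 < 1 + \prod_m rnorm (x m).
    by rewrite ltr_pwDl// prodr_ge0// => m _; exact: rnorm_ge0.
  have [i0 Hi] := uA _ (divr_gt0 e0 p0); exists i0 => // i /= i0i.
  apply: le_lt_trans (Hi _ i0i x) _.
  by rewrite -mulrA gtr_pMr// mulrC ltr_pdivrMr// mul1r ltrDr.
split => [x m a y z|x0].
  have uL : u i (dfwith x m (a *: y + z)) @[i --> \oo] -->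
      a *: A (dfwith x m y) + A (dfwith x m z).
    have -> : (fun i => u i (dfwith x m (a *: y + z))) =
        (fun i => a *: u i (dfwith x m y) + u i (dfwith x m z)).
      by apply/funext => i; exact: (um i).1.
    exact: (cvgD (cvgZl_tmp (k := a) (uAx _)) (uAx _)).
  exact (cvg_unique (@norm_hausdorff K F) (uAx _) uL).
apply/(cvg_rnormP (nbhs_filter (x0 : prod_topology E))) => e e0.
pose B := \prod_m (rnorm (x0 m) + 1).
have B0 : 0 < B by apply: prodr_gt0 => m _; rewrite ltr_wpDl// rnorm_ge0.
have e3 : 0 < e / 3 by rewrite divr_gt0.
have [i Hi] := uA _ (divr_gt0 e3 B0).
have near_le x : (forall m, rnorm (x m) < rnorm (x0 m) + 1) ->
    rnorm (u i x - A x) <= e / 3.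
  move=> xB; apply: le_trans (Hi i (leqnn i) x) _.
  rewrite -[leRHS](divfK (lt0r_neq0 B0)).
  apply: ler_wpM2l; first by rewrite divr_ge0 ?ltW.
  by apply: ler_prod => m _; rewrite rnorm_ge0 ltW.
have /cvg_rnormP/(_ _ e3) uic := (um i).2 x0.
apply: filterS2 uic (near_coord_rnorm_lt x0) => x ux xB.
have h0 := near_le x0 (fun m => ltr_pwDr ltr01 (lexx _)).
have h := near_le x xB.
have -> : A x - A x0 = - (u i x - A x) + (u i x - u i x0) + (u i x0 - A x0).
  by rewrite opprB !subrKA.
apply: le_lt_trans (rnormD _ _) _.
have := rnormD (- (u i x - A x)) (u i x - u i x0); rewrite rnormN; lra.
Qed.

Variables (X : 'I_n -> sequence_class R k) (Y : sequence_class R k).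

Lemma component_L_class E F :
  component (L_class X Y) (E := E) (F := F) = L_class X Y (E := E) (F := F).
Proof. by apply/seteqP; split => [A []//|A LA]; split => //; case: LA. Qed.

Lemma inducedZD E F (a : K) (A B : (forall m, E m) -> F) x :
  induced (a *: A + B) x = a *: induced A x + induced B x.
Proof. by []. Qed.

Lemma L_class0 E F : L_class X Y (0 : (forall m, E m) -> F).
Proof.
split=> [|x Xx]; last exact: cn_subspace0 (seq_banach Y F).
split=> [x m a y z|]; first by rewrite /= scaler0 addr0.
exact (@cst_continuous (prod_topology E) F 0).
Qed.

Lemma L_classZD E F (a : K) (A B : (forall m, E m) -> F) :
  L_class X Y A -> L_class X Y B -> L_class X Y (a *: A + B).
Proof.
move=> [Ac AXY] [Bc BXY]; split; first exact: cmultilinearZD.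
move=> x Xx; rewrite inducedZD.
by apply: (cn_subspaceP (seq_banach Y F)); [exact: AXY|exact: BXY].
Qed.

Lemma inducedB E F (A B : (forall m, E m) -> F) x :
  induced (A - B) x = induced A x - induced B x.
Proof. by []. Qed.

Lemma L_classB E F (A B : (forall m, E m) -> F) :
  L_class X Y A -> L_class X Y B -> L_class X Y (A - B).
Proof. by move=> LA LB; rewrite addrC -scaleN1r; exact: L_classZD. Qed.

Lemma L_normZ_le E F (a : K) (A : (forall m, E m) -> F) : L_class X Y A ->
  L_norm X Y (a *: A) <= rnorm (a : KB) * L_norm X Y A.
Proof.
move=> LA; apply: L_norm_le => x Hx.
rewrite -[induced _ _]/(a *: induced A x) (cn_homog (seq_banach Y F)).
  by apply: ler_wpM2l; [exact: rnorm_ge0|exact: induced_unit_le].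
by apply: LA.2 => m; have [] := Hx m.
Qed.

Lemma L_normZ E F (a : K) (A : (forall m, E m) -> F) : L_class X Y A ->
  L_norm X Y (a *: A) = rnorm (a : KB) * L_norm X Y A.
Proof.
move=> LA; apply/eqP; rewrite eq_le L_normZ_le//=.
have LaA : L_class X Y (a *: A).
  by rewrite -[_ *: _]addr0; apply: L_classZD => //; exact: L_class0.
have [->|a0] := eqVneq a 0.
  by rewrite (rnorm0 KB) mul0r scale0r; apply: L_norm_ge0; exact: L_class0.
have := L_normZ_le a^-1 LaA; rewrite scalerA mulVf// scale1r => h.
have := ler_wpM2l (rnorm_ge0 (a : KB)) h.
by rewrite mulrA -rnormM mulfV// rnorm1 mul1r.
Qed.

Lemma L_normD E F (A B : (forall m, E m) -> F) :
  L_class X Y A -> L_class X Y B ->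
  L_norm X Y (A + B) <= L_norm X Y A + L_norm X Y B.
Proof.
move=> LA LB; apply: L_norm_le => x Hx.
rewrite -[induced _ _]/(induced A x + induced B x).
apply: le_trans (cn_triangle (seq_banach Y F) _ _) _.
- by apply: LA.2 => m; have [] := Hx m.
- by apply: LB.2 => m; have [] := Hx m.
by apply: lerD; exact: induced_unit_le.
Qed.

Hypothesis X_stable : forall m, linearly_stable (X m).

Lemma L_norm_eq0 E F (A : (forall m, E m) -> F) :
  L_class X Y A -> L_norm X Y A = 0 -> A = 0.
Proof.
move=> LA A0; apply/funext => x; apply: (@rnorm0_eq0 R k); apply: le_anti.
rewrite rnorm_ge0 andbT.
by have := value_norm_le X_stable x LA; rewrite A0 mul0r.
Qed.

(** The pointwise limit [A] exists by [value_norm_le], and the sequences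
    [induced (u i) x] converge in [Y F] by [induced_norm_le]; comparing
    coordinates, their limit is [induced A x]. *)
Lemma L_class_complete E F (u : nat -> (forall m, E m) -> F) :
    (forall i, L_class X Y (u i)) ->
    (forall e : R, 0 < e -> exists i0, forall i j, (i0 <= i)%N -> (i0 <= j)%N ->
       L_norm X Y (u i - u j) < e) ->
  exists2 A, L_class X Y A & L_norm X Y (u i - A) @[i --> \oo] --> (0 : R).
Proof.
move=> Lu uC.
have ucvg x : cvg (u i x @[i --> \oo]).
  apply: cvg_of_rnorm_cauchy => e e0.
  have p0 : 0 < 1 + \prod_m rnorm (x m).
    by rewrite ltr_pwDl// prodr_ge0// => m _; exact: rnorm_ge0.
  have [i0 Hi] := uC _ (divr_gt0 e0 p0); exists i0 => i j i0i i0j.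
  apply: le_lt_trans (value_norm_le X_stable x (L_classB (Lu i) (Lu j))) _.
  apply: (@le_lt_trans _ _ (e / (1 + \prod_m rnorm (x m)) * \prod_m rnorm (x m))).
    apply: ler_wpM2r; last by rewrite ltW// Hi.
    by apply: prodr_ge0 => m _; exact: rnorm_ge0.
  by rewrite -mulrA gtr_pMr// mulrC ltr_pdivrMr// mul1r ltrDr.
pose A x := lim (u i x @[i --> \oo]).
have uA x : u i x @[i --> \oo] --> A x by exact: ucvg.
have uA_unif (e : R) : 0 < e -> exists i0, forall i, (i0 <= i)%N -> forall x,
    rnorm (u i x - A x) <= e * \prod_m rnorm (x m).
  move=> e0; have [i0 Hi] := uC _ e0; exists i0 => i i0i x.
  apply: (@rnorm_cvg_le F nat \oo _ (fun j => u i x - u j x)).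
    by apply: cvgB; [exact: cvg_cst|exact: uA].
  exists i0 => // j /= i0j.
  apply: le_trans (value_norm_le X_stable x (L_classB (Lu i) (Lu j))) _.
  apply: ler_wpM2r; last by rewrite ltW// Hi.
  by apply: prodr_ge0 => m _; exact: rnorm_ge0.
have Acm : cmultilinear A.
  by apply: cmultilinear_limit uA_unif => i; exact: (Lu i).1.
have uY x : (forall m, X m (E m) (x m)) -> Y F (induced A x) /\
    seq_norm Y (induced (u i) x - induced A x) @[i --> \oo] --> (0 : R).
  move=> Xx; have Yu i : Y F (induced (u i) x) by exact: (Lu i).2.
  pose P := \prod_m seq_norm (X m) (x m).
  have P0 : 0 <= P.
    by apply: prodr_ge0 => m _; apply: (cn_ge0 (seq_banach _ _)).
  have [e e0|y Yy uy] := cn_complete (seq_banach Y F) Yu.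
    have p0 : 0 < 1 + P by rewrite ltr_pwDl.
    have [i0 Hi] := uC _ (divr_gt0 e0 p0); exists i0 => i j i0i i0j.
    rewrite -inducedB.
    apply: le_lt_trans (induced_norm_le (L_classB (Lu i) (Lu j)) Xx) _.
    apply: (@le_lt_trans _ _ (e / (1 + P) * P)).
      by apply: ler_wpM2r => //; rewrite ltW// Hi.
    by rewrite -mulrA gtr_pMr// mulrC ltr_pdivrMr// mul1r ltrDr.
  have yE : induced A x = y.
    apply/funext => j.
    have uyj := seq_norm_cvg_coord (GF := eventually_filter) Yu Yy uy (j := j).
    exact (cvg_unique (@norm_hausdorff K F) (uA _) uyj).
  by rewrite yE.
have LA : L_class X Y A by split => // x Xx; have [] := uY x Xx.
exists A => //.
apply/cvgrPdist_lt => e e0; have e2 : 0 < e / 2 by rewrite divr_gt0.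
have [i0 Hi] := uC _ e2; exists i0 => // i /= i0i.
rewrite sub0r normrN ger0_norm; last by apply: L_norm_ge0; exact: L_classB.
apply: (@le_lt_trans _ _ (e / 2)); last by lra.
apply: L_norm_le => x Hx; apply/ler_addgt0Pr => d d0.
have Xx m : X m (E m) (x m) by have [] := Hx m.
have [YA /cvgrPdist_lt/(_ _ d0)[j0 _ Hj]] := uY x Xx.
have Yu j : Y F (induced (u j) x) by exact: (Lu j).2.
have := Hj (maxn i0 j0) (leq_maxr _ _).
rewrite /= sub0r normrN ger0_norm; last first.
  by apply: (cn_ge0 (seq_banach _ _)); exact: (cn_spaceB (seq_banach _ _)).
have := cn_dist_triangle (seq_banach Y F) (Yu i) YA (Yu (maxn i0 j0)).
have := induced_unit_le (L_classB (Lu i) (Lu (maxn i0 j0))) Hx.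
have := Hi i (maxn i0 j0) i0i (leq_maxl _ _).
rewrite -!inducedB; lra.
Qed.

Lemma L_class_banach E F : complete_norm
  (L_class X Y (E := E) (F := F)) (L_norm X Y (E := E) (F := F)).
Proof.
split.
- exact: L_class0.
- by move=> a A B; exact: L_classZD.
- by move=> A; exact: L_norm_ge0.
- by move=> A; exact: L_norm_eq0.
- by move=> a A; exact: L_normZ.
- by move=> A B; exact: L_normD.
- by move=> u; exact: L_class_complete.
Qed.

End Completeness.

(** * Finite type operators and the ideal property *)

Section Ideal.
Variables (R : realType) (k : field_kind) (n : nat).
Local Notation K := (ground_field R k).
Local Notation KB := (ground_banach R k).
Local Notation banach := (completeNormedModType K).
Implicit Types (E G : 'I_n -> banach) (F H : banach).
Variables (X : 'I_n -> sequence_class R k) (Y : sequence_class R k).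

Lemma compose_dfwith E G (u : forall m, G m -> E m) x m (y : G m) :
  (fun i => u i (dfwith x m y i)) = dfwith (fun i => u i (x i)) m (u m y).
Proof.
apply: functional_extensionality_dep => i.
by case: (dfwithP x y) => [|j mj]; rewrite ?dfwithin// dfwithout.
Qed.

Lemma continuous_pointwise (D : topologicalType) (I : Type)
    (T : I -> topologicalType) (f : D -> prod_topology T) :
  (forall i, continuous (fun x => f x i)) -> continuous f.
Proof.
move=> fc x; apply/cvg_sup => i.
exact: (@continuous_comp_initial _ D (T i) (fun g => g i) f (fc i) x).
Qed.

Lemma compose_cmultilinear E G F H (A : (forall m, E m) -> F)
    (u : forall m, {linear G m -> E m}) (v : {linear F -> H}) :
    cmultilinear A -> (forall m, continuous (u m)) -> continuous v ->
  cmultilinear (compose v A u).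
Proof.
move=> [Am Ac] uc vc; split => [x m a y z|].
  by rewrite /compose !(compose_dfwith (fun m => u m)) linearP Am linearP.
have uxc : continuous
    ((fun x m => u m (x m)) : prod_topology G -> prod_topology E).
  apply: continuous_pointwise => m x.
  exact: (cvg_comp _ _ (@proj_continuous _ G m x) (uc m (x m))).
move=> x; exact: (cvg_comp _ _ (cvg_comp _ _ (uxc x) (Ac _)) (vc _)).
Qed.

Lemma continuous_prod (D : topologicalType) (r : seq 'I_n) (f : 'I_n -> D -> KB) :
  (forall m, continuous (f m)) ->
  continuous ((fun x => \prod_(m <- r) (f m x : K)) : D -> KB).
Proof.
move=> fc; elim: r => [|m r IH] x.
  under eq_fun do rewrite big_nil.
  exact (@cst_continuous D KB 1 x).
have -> : (fun x => \prod_(i <- m :: r) (f i x : K)) =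
    (fun x => (f m x : K) * \prod_(i <- r) (f i x : K)).
  by apply/funext => y; rewrite big_cons.
exact: (@cvgM K D (nbhs x) _ (f m) (fun x => \prod_(i <- r) (f i x : K))
  _ _ (fc m x) (IH x)).
Qed.

Lemma rank_one_cmultilinear E F (phi : forall m, {linear E m -> KB}) (b : F) :
    (forall m, continuous (phi m)) ->
  cmultilinear (fun x => (\prod_m (phi m (x m) : K)) *: b).
Proof.
move=> phic; split => [x m a y z|].
  have step w : \prod_i (phi i (dfwith x m w i) : K) =
      (phi m w : K) * \prod_(i | i != m) (phi i (x i) : K).
    rewrite (bigD1 m)//= dfwithin; congr (_ * _).
    by apply: eq_bigr => i im; rewrite dfwithout// eq_sym.
  rewrite !step linearP scalerA -scalerDl mulrA -mulrDl.
  by [].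
have pc : continuous
    ((fun x => \prod_m (phi m (x m) : K)) : prod_topology E -> KB).
  apply: (@continuous_prod (prod_topology E) _ (fun m x => phi m (x m))) => m x.
  exact: (cvg_comp _ _ (@proj_continuous _ E m x) (phic m (x m))).
move=> x; exact: (cvg_comp _ _ (pc x) (@scale_vector_continuous R k F b _)).
Qed.

Hypothesis X_stable : forall m, linearly_stable (X m).
Hypothesis Y_stable : linearly_stable Y.
Hypothesis XY : scalar_embedding X Y.

(** The embedding hypothesis handles the product of the scalar sequences
    [phi m \o x m], linear stability of [Y] the multiplication by [b]. *)
Lemma rank_one_L_class E F (phi : forall m, {linear E m -> KB}) (b : F) :
    (forall m, continuous (phi m)) ->
  L_class X Y (fun x => (\prod_m (phi m (x m) : K)) *: b).
Proof.
move=> phic; split; first exact: rank_one_cmultilinear.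
move=> x Xx; have [|Yprod _] := XY (lam := fun m => phi m \o x m).
  by move=> m; exact: stable_space.
exact: (stable_space Y_stable (@scale_vector_continuous R k F b) Yprod).
Qed.

Lemma finite_type_L_class E F (A : (forall m, E m) -> F) :
  finite_type A -> L_class X Y A.
Proof.
move=> [r [c [phi [b [phic ->]]]]].
have -> : (fun x => \sum_i c i *: ((\prod_m (phi i m (x m) : K)) *: b i)) =
    \sum_i c i *:
      (fun x : forall m, E m => (\prod_m (phi i m (x m) : K)) *: b i).
  by apply/funext => x; rewrite fct_sumE.
have cn := L_class_banach Y X_stable E F.
apply: (cn_space_sum cn) => i; apply: (cn_spaceZ cn); exact: rank_one_L_class.
Qed.

(** The value 1 is attained when all [n] sequences are the same unit sequence;
    for [n = 0] the empty product would be the constant sequence 1 instead. *)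
Lemma mul_op_norm : (0 < n)%N -> L_norm X Y (@mul_op R k n) = 1.
Proof.
move=> n0.
have mul_le (x : 'I_n -> nat -> KB) :
    (forall m, X m KB (x m) /\ seq_norm (X m) (x m) <= 1) ->
    seq_norm Y (induced (@mul_op R k n) x) <= 1.
  move=> Hx; have [m|_ /le_trans] := XY (lam := x); first by have [] := Hx m.
  apply; rewrite -[leRHS](@big1_eq _ _ *%R _ (index_enum 'I_n) xpredT).
  apply: ler_prod => m _; have [Xx ->] := Hx m; rewrite andbT.
  by apply: (cn_ge0 (seq_banach _ _)).
apply/eqP; rewrite eq_le (L_norm_le mul_le)/=.
apply: ub_le_sup; first by exists 1 => _ [x Hx <-]; exact: mul_le.
exists (fun m => unit_seq R k 0) => /= [m|].
  by rewrite seq_canon; split => //; exact: unit_seq_space.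
rewrite -[RHS](seq_canon Y 0); congr seq_norm; apply/funext => j.
rewrite /induced /mul_op prodr_const card_ord /unit_seq.
by case: (j == 0%N); rewrite ?expr1n// expr0n gtn_eqF.
Qed.

Lemma compose_L_class E G F H (A : (forall m, E m) -> F)
    (u : forall m, {linear G m -> E m}) (v : {linear F -> H}) :
    L_class X Y A -> (forall m, continuous (u m)) -> continuous v ->
  L_class X Y (compose v A u).
Proof.
move=> [Ac AXY] uc vc; split; first exact: compose_cmultilinear.
move=> x Xx.
apply: (stable_space Y_stable vc (x := induced A (fun m => u m \o x m))).
by apply: AXY => m; exact: stable_space.
Qed.

Lemma compose_L_norm_le E G F H (A : (forall m, E m) -> F)
    (u : forall m, {linear G m -> E m}) (v : {linear F -> H}) :
    L_class X Y A -> (forall m, continuous (u m)) -> continuous v ->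
  L_norm X Y (compose v A u) <= opnorm v * L_norm X Y A * \prod_m opnorm (u m).
Proof.
move=> LA uc vc; apply: L_norm_le => x Hx.
have Xux m : X m (E m) (u m \o x m).
  by apply: stable_space => //; have [] := Hx m.
apply: le_trans (stable_norm_le Y_stable vc (LA.2 _ Xux)) _.
rewrite -mulrA; apply: ler_wpM2l; first exact: opnorm_ge0.
apply: le_trans (induced_norm_le LA Xux) _.
apply: ler_wpM2l; first exact: L_norm_ge0.
apply: ler_prod => m _; apply/andP; split.
  by apply: (cn_ge0 (seq_banach _ _)).
have [Xx x1] := Hx m; apply: le_trans (stable_norm_le (X_stable m) (uc m) Xx) _.
by rewrite ler_piMr// opnorm_ge0.
Qed.

End Ideal.

Theorem theorem2p6 (R : realType) (k : field_kind) (n : nat) (n_gt0 : (0 < n)%N)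
    (X : 'I_n -> sequence_class R k) (Y : sequence_class R k)
    (X_stable : forall m : 'I_n, linearly_stable (X m))
    (Y_stable : linearly_stable Y)
    (XY : scalar_embedding X Y) :
  banach_ideal (L_class X Y) (L_norm X Y).
Proof.
split.
- by move=> E F A [[]].
- by move=> E F; rewrite component_L_class; exact: L_class_banach.
- by move=> E F A fA; rewrite component_L_class; exact: finite_type_L_class.
- exact: mul_op_norm.
- move=> E G F H A u v; rewrite !component_L_class => LA uc vc.
  by split; [exact: compose_L_class|exact: compose_L_norm_le].
Qed.
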